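(* Let $n\ge 1$ and let $Y_1,\ldots,Y_n$ be i.i.d. random variables with density $f(y)$ on $\mathbf{R}_+=(0,\infty)$ such that $x\mapsto f(e^x)$ is log-concave in $x\in\mathbf{R}$. Then, for each $t>0$, $\Pr\left(\sum_{i=1}^n a_iY_i\le t\right)$, $a\in\mathbf{R}_+^n$, is a Schur-concave function of $\log a\equiv(\log a_1,\ldots,\log a_n)\in\mathbf{R}^n$ (that is, $\alpha\mapsto\Pr\left(\sum_{i=1}^n e^{\alpha_i}Y_i\le t\right)$ is Schur-concave on $\mathbf{R}^n$). Equivalently, if $a,b\in\mathbf{R}_+^n$, then $$\log a\prec\log b\quad\Longrightarrow\quad \sum_{i=1}^n a_iY_i\le_{\mathrm{st}}\sum_{i=1}^n b_iY_i .$$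
   Context: Usual stochastic order: for real random variables $X,Y$, $X\le_{\mathrm{st}}Y$ means $\Pr(X>t)\le\Pr(Y>t)$ for all $t\in\mathbf{R}$. Majorization: for $a,b\in\mathbf{R}^n$, $a\prec b$ means (i) $\sum_{i=1}^n a_i=\sum_{i=1}^n b_i$ and (ii) $\sum_{i=k}^n a_{(i)}\le\sum_{i=k}^n b_{(i)}$ for $k=2,\ldots,n$, where $a_{(1)}\le\cdots\le a_{(n)}$ and $b_{(1)}\le\cdots\le b_{(n)}$ are the coordinates arranged in increasing order. A function $\phi$ symmetric in its $n$ coordinates is Schur-concave if $a\prec b$ implies $\phi(a)\ge\phi(b)$. A non-negative function $g$ on $\mathbf{R}^n$ is log-concave if $\operatorname{supp}(g)=\{x: g(x)>0\}$ is convex and $\log g$ is concave on $\operatorname{supp}(g)$. ''Density'' means density with respect to Lebesgue measure. *)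

(* Defs.v *)
From HB Require Import structures.
From mathcomp Require Import all_boot all_order all_algebra all_fingroup.
From mathcomp Require Import all_classical all_reals all_analysis measurable_realfun.
Import Order.TTheory GRing.Theory Num.Theory.
Import numFieldNormedType.Exports.

Set Implicit Arguments.
Unset Strict Implicit.
Unset Printing Implicit Defensive.

Local Open Scope classical_set_scope.
Local Open Scope ring_scope.

(* Order statistics are numbered from 1: [order_stat a k] is a_(k), for
   1 <= k <= n. *)
Definition order_stat (R : realType) (n : nat) (a : 'rV[R]_n) (k : nat) : R :=
  nth 0 (sort <=%R [seq a ord0 i | i <- enum 'I_n]) k.-1.

Definition majorized (R : realType) (n : nat) (a b : 'rV[R]_n) : Prop :=
  \sum_(i < n) a ord0 i = \sum_(i < n) b ord0 i /\
  forall k : nat, (2 <= k <= n)%N ->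
    \sum_(k <= i < n.+1) order_stat a i <= \sum_(k <= i < n.+1) order_stat b i.

Definition symmetric_coords (R : realType) (n : nat) (phi : 'rV[R]_n -> R)
    : Prop :=
  forall (s : 'S_n) (a : 'rV[R]_n), phi (col_perm s a) = phi a.

Definition schur_concave (R : realType) (n : nat) (phi : 'rV[R]_n -> R)
    : Prop :=
  symmetric_coords phi /\
  forall a b : 'rV[R]_n, majorized a b -> phi b <= phi a.

Definition concave_function (R : realType) (V : lmodType R)
    (D : set (convex_lmodType V)) (g : V -> R) : Prop :=
  @convex_function R V D (fun x => - g x).

Definition log_concave (R : realType) (V : lmodType R) (g : V -> R) : Prop :=
  let supp : set (convex_lmodType V) := [set x | 0 < g x] in
  [/\ forall x : V, 0 <= g x,
      convex_set supp &
      concave_function supp (fun x => ln (g x))].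

(* Only the values of [f] on [D] matter: the density is [f] on [D] and 0
   elsewhere. *)
Definition has_density (R : realType) (d : measure_display)
    (T : measurableType d) (P : probability T R) (X : {RV P >-> R})
    (D : set R) (f : R -> R) : Prop :=
  [/\ measurable_fun D f,
      forall x : R, D x -> 0 <= f x &
      forall A : set R, measurable A ->
        distribution P X A =
        (\int[@lebesgue_measure R]_(x in A `&` D) (f x)%:E)%E].

Definition mutually_independent (R : realType) (d : measure_display)
    (T : measurableType d) (P : probability T R) (n : nat)
    (Y : 'I_n -> {RV P >-> R}) : Prop :=
  forall (J : {set 'I_n}) (A : 'I_n -> set R),
    (forall i : 'I_n, measurable (A i)) ->
    P (\bigcap_(i in [set` J]) (Y i @^-1` A i)) =
    (\prod_(i in J) P (Y i @^-1` A i))%E.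

Section weighted_sum.
Context (R : realType) (d : measure_display) (T : measurableType d)
  (P : probability T R) (n : nat).

Definition weighted_sum (a : 'rV[R]_n) (Y : 'I_n -> {RV P >-> R}) (w : T) : R :=
  \sum_(i < n) a ord0 i * Y i w.

Lemma measurable_weighted_sum (a : 'rV[R]_n) (Y : 'I_n -> {RV P >-> R}) :
  measurable_fun setT (weighted_sum a Y).
Proof.
by apply: measurable_sum => i; exact: measurable_funM.
Qed.

HB.instance Definition _ (a : 'rV[R]_n) (Y : 'I_n -> {RV P >-> R}) :=
  isMeasurableFun.Build _ _ T R (weighted_sum a Y)
    (measurable_weighted_sum a Y).

End weighted_sum.

Definition st_le (R : realType)
    (d1 : measure_display) (T1 : measurableType d1) (P1 : probability T1 R)
    (X1 : {RV P1 >-> R})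
    (d2 : measure_display) (T2 : measurableType d2) (P2 : probability T2 R)
    (X2 : {RV P2 >-> R}) : Prop :=
  forall t : R, (ccdf X1 t <= ccdf X2 t)%E.

(* Main.v *)
(* Majorization is generated by transfers b -> a that change two coordinates,
   keep their sum and bring them closer together, so it suffices to compare
   P(b1 Y1 + b2 Y2 + Z <= t) and P(a1 Y1 + a2 Y2 + Z <= t) when
   a1 a2 = b1 b2, b2 <= a1, a2 <= b1 and Z is independent of (Y1, Y2); as Z can
   be integrated out, take Z = 0. With k = b1 / a2 >= 1, the map
   (x, y) |-> (y / k, k x) preserves the Lebesgue measure of the plane and
   exchanges the two linear forms, hence sends {L_b <= s < L_a} to
   {L_a <= s < L_b}. On the former set it keeps the product xy and moves the
   two coordinates between x and y, so log-concavity of f(e^x) makes the joint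
   density f(x) f(y) larger at the image. *)
Require Import Defs.
From HB Require Import structures.
From mathcomp Require Import all_boot all_order all_algebra all_fingroup.
From mathcomp Require Import all_classical all_reals all_analysis measurable_realfun.
From mathcomp Require Import ring lra.
Import Order.TTheory GRing.Theory Num.Theory.
Import numFieldNormedType.Exports.

Local Open Scope classical_set_scope.
Local Open Scope ring_scope.

(** * Schur-concavity from transfers between two coordinates *)

Definition transfer_monotone (R : realType) (n : nat) (phi : 'rV[R]_n -> R) :=
  forall (i j : 'I_n) (a b : 'rV[R]_n), i != j ->
    (forall k, k != i -> k != j -> a ord0 k = b ord0 k) ->
    a ord0 i + a ord0 j = b ord0 i + b ord0 j ->
    b ord0 j <= a ord0 i <= b ord0 i -> phi b <= phi a.

(** Swapping two coordinates is an extreme transfer, with a_i = b_j, so it cannot decrease [phi];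
    being an involution, it cannot increase it either. Transpositions generate all permutations. *)
Lemma transfer_monotone_sym (R : realType) (n : nat) (phi : 'rV[R]_n -> R) :
  transfer_monotone R n phi -> symmetric_coords phi.
Proof.
move=> phiT s; have [ts -> _] := prod_tpermP s.
have swap_le x y c : phi c <= phi (col_perm (tperm x y) c).
  have [->|xy] := eqVneq x y; first by rewrite tperm1 col_perm1.
  wlog cyx : x y xy / c ord0 y <= c ord0 x => [wl|].
    have [/wl->//|/ltW/wl] := leP (c ord0 y) (c ord0 x).
    by rewrite tpermC eq_sym; apply.
  apply: (phiT x y); rewrite ?mxE ?tpermL ?tpermR ?lexx //=;
    last by rewrite addrC.
  by move=> k kx ky; rewrite mxE tpermD // eq_sym.
elim: ts => [|[x y] ts IHts] a; first by rewrite big_nil col_perm1.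
rewrite big_cons col_permM /= -[RHS]IHts.
apply/eqP; rewrite eq_le swap_le andbT.
apply: le_trans (swap_le x y _) _.
by rewrite -col_permM tperm2 col_perm1.
Qed.

(* The transfer goes from the last i with b_i < a_i to some j > i with
   a_j < b_j, by the largest amount that keeps b_i <= a_i and a_j <= b_j: this
   preserves the tail inequalities even though b need not stay sorted, and
   makes one more coordinate agree. *)
Lemma transfer_monotone_sorted (R : realType) (n : nat) (phi : 'rV[R]_n -> R)
    (a b : 'rV[R]_n) :
  transfer_monotone R n phi ->
  (forall i j : 'I_n, (i <= j)%N -> a ord0 i <= a ord0 j) ->
  \sum_i a ord0 i = \sum_i b ord0 i ->
  (forall k : nat, \sum_(i < n | (k <= i)%N) a ord0 i <=
                   \sum_(i < n | (k <= i)%N) b ord0 i) ->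
  phi b <= phi a.
Proof.
move=> phiT a_sorted.
have [m] := ubnP #|[pred i | a ord0 i != b ord0 i]|.
elim: m => // m IHm in b *; rewrite ltnS => diff_le sum_eq tail_le.
have [[i0 ab0]|/forallNP ab] :=
  pselect (exists i, b ord0 i < a ord0 i); last first.
  suff -> : a = b by [].
  have ab_le i : true -> a ord0 i <= b ord0 i.
    by move=> _; rewrite leNgt; apply/negP; exact: ab.
  apply/rowP => i; apply/eqP.
  rewrite -subr_eq0 -oppr_eq0 opprB.
  have /eqP := sum_eq; rewrite eq_sym -subr_eq0 -sumrB psumr_eq0; last first.
    by move=> k _; rewrite subr_ge0 ab_le.
  by move=> /allP/(_ i); rewrite mem_index_enum; apply.
have [i abi i_max] := @arg_maxnP _ i0 (fun i => b ord0 i < a ord0 i) val ab0.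
(* Otherwise b <= a at every index after i, and since b_i < a_i the tail inequality at i would
   fail. *)
have [j [ij abj]] : exists j : 'I_n, (i < j)%N /\ a ord0 j < b ord0 j.
  apply: contrapT => /forallNP nj.
  have := tail_le i; rewrite leNgt => /negP; apply.
  rewrite (bigD1 i) //= [ltRHS](bigD1 i) //=; apply: ltr_leD => //.
  apply: ler_sum => k /andP[ik ki]; rewrite leNgt; apply/negP => abk.
  by apply: (nj k); split=> //; rewrite ltn_neqAle ik eq_sym andbT; exact: ki.
have above (k : 'I_n) : (i < k)%N -> a ord0 k <= b ord0 k.
  by move=> ik; rewrite leNgt; apply/negP => /i_max; rewrite /= leqNgt ik.
have ji : j != i by apply: contraTneq ij => ->; rewrite ltnn.
pose e := Num.min (a ord0 i - b ord0 i) (b ord0 j - a ord0 j).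
have e_gt0 : 0 < e by rewrite lt_min !subr_gt0 abi.
have e_i : e <= a ord0 i - b ord0 i by rewrite ge_min lexx.
have e_j : e <= b ord0 j - a ord0 j by rewrite ge_min lexx orbT.
(* Together with b_i < a_i and a_j < b_j, this makes b_j the larger coordinate and keeps b_j - e
   above b_i, as a transfer requires. *)
have aij : a ord0 i <= a ord0 j by apply: a_sorted; exact: ltnW.
pose b' : 'rV[R]_n :=
  \row_k (b ord0 k + (if k == i then e else 0) - (if k == j then e else 0)).
have b'i : b' ord0 i = b ord0 i + e by rewrite mxE eqxx eq_sym (negPf ji) subr0.
have b'j : b' ord0 j = b ord0 j - e by rewrite mxE eqxx (negPf ji) addr0.
have b'E (k : 'I_n) : k != i -> k != j -> b' ord0 k = b ord0 k.
  by move=> /negPf ki /negPf kj; rewrite mxE ki kj addr0 subr0.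
have sum_b' (Q : pred 'I_n) : \sum_(k | Q k) b' ord0 k =
    \sum_(k | Q k) b ord0 k + (if Q i then e else 0) - (if Q j then e else 0).
  under eq_bigr do rewrite mxE.
  rewrite sumrB big_split /= -!big_mkcondr /=; congr (_ + _ - _).
    by rewrite big_mkcond (bigD1 i) //= eqxx andbT big1 ?addr0 // => k /negPf ->;
      rewrite andbF.
  by rewrite big_mkcond (bigD1 j) //= eqxx andbT big1 ?addr0 // => k /negPf ->;
      rewrite andbF.
apply: (@le_trans _ _ (phi b')).
  apply: (phiT j i) => //; rewrite ?b'i ?b'j.
    by move=> k kj ki; exact: b'E.
    by ring.
  by apply/andP; split; lra.
apply: IHm.
- apply: leq_trans diff_le; apply: proper_card; apply/fintype.properP; split.
    apply/fintype.subsetP => k; rewrite !inE; have [->|ki] := eqVneq k i.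
      by move=> _; rewrite gt_eqF.
    have [->|kj] := eqVneq k j; first by move=> _; rewrite lt_eqF.
    by rewrite b'E.
  (* The minimum [e] equals one of the two gaps, so coordinate i or j now agrees with [a]. *)
  have [eE|eE] : e = a ord0 i - b ord0 i \/ e = b ord0 j - a ord0 j.
    by rewrite /e; case: leP; [left|right].
    exists i; rewrite inE /= ?b'i ?eE ?(addrC (b _ _)) ?subrK ?eqxx //.
    by rewrite gt_eqF.
  by exists j; rewrite inE /= ?b'j ?eE ?subKr ?eqxx // lt_eqF.
- by rewrite sum_b' addrK.
- move=> k; rewrite sum_b'.
  (* A tail from k <= i contains both changes, which cancel. A tail from i < k <= j loses e, but the
     gap at j is at least e and a <= b at the other indices past i. *)
  have [ki|ik] := leqP k i.
    by rewrite (leq_trans ki (ltnW ij)) addrK.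
  rewrite addr0; have [kj|jk] := leqP k j; last by rewrite subr0.
  rewrite (bigD1 j) //= [in leRHS](bigD1 j) //=.
  have : \sum_(l < n | (k <= l)%N && (l != j)) a ord0 l <=
         \sum_(l < n | (k <= l)%N && (l != j)) b ord0 l.
    by apply: ler_sum => l /andP[kl _]; apply: above; exact: leq_trans kl.
  by lra.
Qed.

Lemma exists_sorting_perm (R : realType) (n : nat) (a : 'rV[R]_n) :
  exists s : 'S_n,
    forall i : 'I_n, order_stat a i.+1 = col_perm s a ord0 i.
Proof.
set l := [seq a ord0 i | i <- enum 'I_n].
have szl : size (sort <=%R l) == n by rewrite size_sort size_map size_enum_ord.
have /tuple_permP[s lE] : perm_eq (sort <=%R l) [tuple a ord0 i | i < n].
  by rewrite perm_sort /= perm_refl.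
exists s => i; rewrite /order_stat -/l lE /= mxE.
rewrite (nth_map i) ?size_enum_ord // nth_ord_enum tnth_mktuple //.
Qed.

Lemma order_stat_nondecreasing (R : realType) (n : nat)
    (a : 'rV[R]_n) (i j : nat) :
  (i <= j < n)%N -> order_stat a i.+1 <= order_stat a j.+1.
Proof.
move=> /andP[ij jn].
have szl : size (sort <=%R [seq a ord0 i | i <- enum 'I_n]) = n.
  by rewrite size_sort size_map size_enum_ord.
apply: sorted_leq_nth => //; rewrite ?inE ?szl //; [exact: le_trans| |].
  by apply: sort_sorted; exact: le_total.
exact: leq_ltn_trans jn.
Qed.

(** By symmetry both vectors can be sorted increasingly; sums of the largest order statistics then
    become tail sums over indices. *)
Lemma transfer_monotone_schur_concave (R : realType) (n : nat)
    (phi : 'rV[R]_n -> R) :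
  transfer_monotone R n phi -> schur_concave phi.
Proof.
move=> phiT; have phiS := transfer_monotone_sym R n phi phiT.
split=> // a b [sum_eq tail_le].
have [s sE] := exists_sorting_perm R n a.
have [u uE] := exists_sorting_perm R n b.
have sum_perm (v : 'S_n) (c : 'rV[R]_n) :
    \sum_i col_perm v c ord0 i = \sum_i c ord0 i.
  under eq_bigr do rewrite mxE.
  by rewrite [RHS](reindex_inj (@perm_inj _ v)).
have tailE (v : 'S_n) (c : 'rV[R]_n) (k : nat) :
    (forall i : 'I_n, order_stat c i.+1 = col_perm v c ord0 i) ->
    \sum_(i < n | (k <= i)%N) col_perm v c ord0 i =
    \sum_(k.+1 <= i < n.+1) order_stat c i.
  move=> vE; under eq_bigr do rewrite -vE.
  by rewrite big_add1 /= big_geq_mkord; apply: eq_bigl.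
rewrite -(phiS s a) -(phiS u b); apply: transfer_monotone_sorted => //.
- by move=> i j ij; rewrite -!sE order_stat_nondecreasing // ij /=.
- by rewrite !sum_perm.
(* Ordinals start at 0 and order statistics at 1: tail 0 is the equality of sums, tail k+1 is the
   majorization condition at k+2, and tails past the end are empty. *)
- move=> [|k]; first by rewrite !sum_perm sum_eq.
  rewrite !tailE //; have [kn|nk] := leqP k.+2 n; first exact: tail_le.
  by rewrite !big_geq.
Qed.

(** * Independence: from rectangles to general events *)

Lemma finite_measure_prod_unique (R : realType) (d1 d2 : measure_display)
    (T1 : measurableType d1) (T2 : measurableType d2)
    (m1 m2 : {measure set (T1 * T2) -> \bar R}) :
  (m1 setT < +oo)%E ->
  (forall A B, measurable A -> measurable B -> m1 (A `*` B) = m2 (A `*` B)) ->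
  forall E, measurable E -> m1 E = m2 E.
Proof.
move=> m1oo m12 E mE.
pose C : set (set (T1 * T2)) :=
  [set A `*` B | A in measurable & B in measurable].
(* Rectangles form a generating pi-system; as [m1] is finite, the constant sequence [setT] serves as
   the exhaustion. *)
apply: (measure_unique C (fun=> setT)) => //.
- by rewrite measurable_prod_measurableType.
- move=> _ _ [A mA [B mB <-]] [A' mA' [B' mB' <-]]; rewrite -setXI.
  exists (A `&` A'); first exact: measurableI.
  by exists (B `&` B') => //; exact: measurableI.
- by move=> _; exists setT => //; exists setT => //; rewrite setXTT.
- by rewrite bigcup_const.
- by move=> _ [A mA [B mB <-]]; exact: m12.
Qed.

(** As functions of [E], both sides are finite measures: the image under (X, Z) of P restricted to
    [W], and P(W) times the joint law. They agree on rectangles. X and Z may depend on each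
    other. *)
Lemma event_indep_pair (R : realType) (d d1 d2 : measure_display)
    (T : measurableType d) (P : probability T R)
    (T1 : measurableType d1) (T2 : measurableType d2)
    (W : set T) (X : {RV P >-> T1}) (Z : {RV P >-> T2}) :
  measurable W ->
  (forall A B, measurable A -> measurable B ->
    P (W `&` (X @^-1` A `&` Z @^-1` B)) =
    (P W * P (X @^-1` A `&` Z @^-1` B))%E) ->
  forall E, measurable E ->
    P (W `&` [set w | E (X w, Z w)]) = (P W * P [set w | E (X w, Z w)])%E.
Proof.
move=> mW WXZ E mE.
have mXZ : measurable_fun setT (fun w => (X w, Z w)).
  exact: measurable_fun_pair.
pose XZ : {RV P >-> (T1 * T2)%type} := HB.pack (fun w => (X w, Z w))
  (isMeasurableFun.Build _ _ _ _ _ mXZ).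
have PWfin := fin_num_measure P W mW.
pose r : {nonneg R} := NngNum (fine_ge0 (measure_ge0 P W)).
pose m1 := pushforward (mrestr P mW) XZ.
pose m2 := mscale r (distribution P XZ).
have : m1 E = m2 E.
  apply: finite_measure_prod_unique => //=.
    rewrite /pushforward /mrestr preimage_setT setTI.
    by rewrite (le_lt_trans (probability_le1 P mW)) ?ltry.
  move=> A B mA mB; rewrite /m1 /m2 /mscale /distribution /pushforward.
  by rewrite /mrestr /= fineK // setIC; exact: WXZ.
by rewrite /m1 /m2 /mscale /distribution /pushforward /mrestr /= fineK // setIC.
Qed.

Lemma indep_law_pair (R : realType) (d d1 d2 : measure_display)
    (T : measurableType d) (P : probability T R)
    (T1 : measurableType d1) (T2 : measurableType d2)
    (X : T -> T1) (Z : T -> T2)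
    (mu1 : probability T1 R) (mu2 : probability T2 R) :
  measurable_fun setT X -> measurable_fun setT Z ->
  (forall A B, measurable A -> measurable B ->
    P (X @^-1` A `&` Z @^-1` B) = (mu1 A * mu2 B)%E) ->
  forall E, measurable E -> P [set w | E (X w, Z w)] = (mu1 \x mu2)%E E.
Proof.
move=> mX mZ XZ E mE; apply/esym.
pose m := pushforward P (fun w => (X w, Z w)).
apply: (@product_measure_unique _ _ _ _ _ _ _ m) => //=.
exact: measurable_fun_pair.
Qed.

Section independent_family.
Context (R : realType) (d : measure_display) (T : measurableType d)
  (P : probability T R) (n : nat) (Y : 'I_n -> {RV P >-> R}).
Hypothesis Yindep : mutually_independent Y.

Let ev (K : {set 'I_n}) (A : 'I_n -> set R) : set T :=
  \bigcap_(i in [set` K]) (Y i @^-1` A i).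

Let evU1 (j : 'I_n) (K : {set 'I_n}) (A : 'I_n -> set R) (B : set R) :
  j \notin K ->
  ev (j |: K)%SET (fun i => if i == j then B else A i) = Y j @^-1` B `&` ev K A.
Proof.
move=> jK; apply/seteqP; split=> w /=.
  move=> wK; split; first by have := wK j; rewrite /= setU11 eqxx; apply.
  move=> i /= iK; have := wK i; rewrite /= finset.inE iK orbT => /(_ isT).
  by case: eqP => // ij; rewrite -ij iK in jK.
move=> [wj wK] i /=; rewrite finset.inE finset.inE; case: eqP => [->//|_ /= iK].
exact: wK.
Qed.

Let ev1 (j : 'I_n) (B : set R) : ev [set j]%SET (fun=> B) = Y j @^-1` B.
Proof.
apply/seteqP; split=> w /=; first by apply; rewrite /= finset.inE.
by move=> wj i /=; rewrite finset.inE => /eqP ->.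
Qed.

Let mev (K : {set 'I_n}) (A : 'I_n -> set R) :
  (forall i, measurable (A i)) -> measurable (ev K A).
Proof.
move=> mA; apply: fin_bigcap_measurable => // i _.
by rewrite -[X in measurable X]setTI; exact: measurable_funP.
Qed.

(** Induction on [s]. The sum over j :: s is a function of Y_j and the sum over s, so rectangles
    suffice; an event on Y_j alone is then absorbed into [ev] by adding j to [K], which is why [K]
    varies in the induction. *)
Lemma events_indep_sum (c : 'I_n -> R) (s : seq 'I_n) (K : {set 'I_n})
    (A : 'I_n -> set R) (C : set R) :
  uniq s -> {in s, forall k, k \notin K} ->
  (forall i, measurable (A i)) -> measurable C ->
  P (ev K A `&` [set w | C (\sum_(k <- s) c k * Y k w)%R]) =
  (P (ev K A) * P [set w | C (\sum_(k <- s) c k * Y k w)%R])%E.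
Proof.
elim: s => [|j s IHs] in K A C *.
  move=> _ _ mA mC; have [C0|C0] := pselect (C 0).
    have -> : [set w | C (\sum_(k <- [::]) c k * Y k w)] = setT.
      by apply/seteqP; split=> // w _ /=; rewrite big_nil.
    by rewrite setIT probability_setT mule1.
  have -> : [set w | C (\sum_(k <- [::]) c k * Y k w)] = set0.
    by apply/seteqP; split=> // w /=; rewrite big_nil.
  by rewrite setI0 measure0 mule0.
move=> /= /andP[js us] sK mA mC.
have jK : j \notin K by apply: sK; rewrite mem_head.
have mZ : measurable_fun setT (fun w => \sum_(k <- s) c k * Y k w).
  by apply: measurable_sum => i; exact: measurable_funM.
pose Z : {RV P >-> R} := HB.pack (fun w => \sum_(k <- s) c k * Y k w)
  (isMeasurableFun.Build _ _ _ _ _ mZ).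
have setE : [set w | C (\sum_(k <- j :: s) c k * Y k w)] =
    [set w | [set p : R * R | C (c j * p.1 + p.2)] (Y j w, Z w)].
  by apply/seteqP; split=> w /=; rewrite big_cons.
rewrite setE; apply: event_indep_pair; first exact: mev.
- move=> A' B mA' mB; rewrite setICA setIA.
  have mA'' i : measurable (if i == j then A' else A i) by case: ifP.
  rewrite -evU1 // (IHs _ _ B) //; last first.
    move=> k ks; rewrite in_setU1 negb_or sK ?inE ?ks ?orbT // andbT.
    by apply: contraNneq js => <-.
  rewrite -(ev1 j A') (IHs _ _ B) //; last first.
    by move=> k ks; rewrite finset.in_set1; apply: contraNneq js => <-.
  rewrite muleA; congr (_ * _)%E.
  rewrite [LHS]Yindep // [X in (X * _)%E]Yindep // [X in (_ * X)%E]Yindep //.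
  rewrite big_setU1 //= eqxx big_set1 muleC; congr (_ * _)%E.
  by apply: eq_bigr => i iK; case: eqP => // ij; rewrite -ij iK in jK.
- rewrite -[X in measurable X]setTI.
  have : measurable_fun setT (fun p : R * R => c j * p.1 + p.2).
    by apply: measurable_funD => //; exact: measurable_funM.
  by apply.
Qed.

(** A rectangle in (Y_i, Y_j) is an [ev] event on {i, j}, so [events_indep_sum] handles it;
    [event_indep_pair] then passes to any measurable [E]. *)
Lemma pair_indep_sum (c : 'I_n -> R) (i j : 'I_n) (s : seq 'I_n)
    (E : set (R * R)) (C : set R) :
  i != j -> uniq s -> i \notin s -> j \notin s ->
  measurable E -> measurable C ->
  P ([set w | E (Y i w, Y j w)] `&` [set w | C (\sum_(k <- s) c k * Y k w)%R]) =
  (P [set w | E (Y i w, Y j w)] *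
   P [set w | C (\sum_(k <- s) c k * Y k w)%R])%E.
Proof.
move=> ij us iS jS mE mC; rewrite setIC muleC.
apply: event_indep_pair => //.
  have : measurable_fun setT (fun w => \sum_(k <- s) c k * Y k w).
    by apply: measurable_sum => k; exact: measurable_funM.
  by move=> /(_ measurableT C mC); rewrite setTI.
move=> A B mA mB.
have mA' k : measurable (if k == i then A else B) by case: ifP.
have iNj : i \notin [set j]%SET by rewrite finset.in_set1.
rewrite -(ev1 j B) -(evU1 _ _ _ _ iNj) setIC muleC events_indep_sum // => k ks.
rewrite in_setU1 finset.in_set1 negb_or.
by apply/andP; split; apply: contraTneq ks => ->.
Qed.

Lemma pair_indep (i j : 'I_n) (A B : set R) :
  i != j -> measurable A -> measurable B ->
  P (Y i @^-1` A `&` Y j @^-1` B) = (P (Y i @^-1` A) * P (Y j @^-1` B))%E.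
Proof.
move=> ij mA mB.
have mA' k : measurable (if k == i then A else B) by case: ifP.
have iNj : i \notin [set j]%SET by rewrite finset.in_set1.
rewrite -(ev1 j B) -(evU1 _ _ _ _ iNj).
rewrite [LHS]Yindep // big_setU1 //= eqxx big_set1 eq_sym (negPf ij).
by rewrite [in RHS](ev1 j B).
Qed.

End independent_family.

(** * Invariance of plane Lebesgue measure under [swap_scale] *)

Lemma lebesgue_measure_scale (R : realType) (k : R) (A : set R) :
  0 < k -> measurable A ->
  lebesgue_measure ((fun x : R => k * x) @^-1` A) =
  (k^-1%:E * lebesgue_measure A)%E.
Proof.
move=> k0 mA.
have mk : measurable_fun setT ((fun x => k * x) : _ -> measurableTypeR R).
  exact: measurable_funM.
pose r : {nonneg R} := NngNum (ltW k0).
(* The image of k times Lebesgue measure under x -> k x agrees with Lebesgue measure on half-open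
   intervals, hence everywhere. *)
suff -> : lebesgue_measure A =
    pushforward (mscale r (@lebesgue_measure R))
      ((fun x => k * x) : _ -> measurableTypeR R) A.
  by rewrite /pushforward /mscale muleA -EFinM mulVf ?gt_eqF // mul1e.
apply: lebesgue_measure_unique => // _ [[a b]] _ <-.
rewrite [X in _ = (_ * lebesgue_measure X)%E](_ : _ =
    `](a / k), (b / k)]%classic); last first.
  apply/seteqP; split=> x /=; rewrite !in_itv /= ltr_pdivrMr //;
  by rewrite ler_pdivlMr // mulrC.
rewrite !lebesgue_measure_itv /= !lte_fin ltr_pM2r ?invr_gt0 //.
case: ifP => _; last by rewrite mule0.
rewrite !EFinN -!EFinB -EFinM mulrBr; congr (_ - _)%:E;
by rewrite mulrCA mulfV ?gt_eqF // mulr1.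
Qed.

Local Notation plane R := (measurableTypeR R * measurableTypeR R)%type.

(* [measurableTypeR R], the carrier of [lebesgue_measure], is convertible to [R]
   but has another display; products must be formed over the same one. *)
Definition swap_scale (R : realType) (k : R) (p : plane R) : plane R :=
  (p.2 / k, k * p.1).

Lemma measurable_swap_scale (R : realType) (k : R) :
  measurable_fun setT (swap_scale R k).
Proof. by apply: measurable_fun_pair; apply: measurable_funM. Qed.

(** Rectangles suffice: the preimage of A x B is (B / k) x (k A), and the factors 1/k and k
    cancel. *)
Lemma lebesgue_swap_scale (R : realType) (k : R) (E : set (plane R)) :
  0 < k -> measurable E ->
  (pushforward (@lebesgue_measure R \x @lebesgue_measure R) (swap_scale R k) E =
  (@lebesgue_measure R \x @lebesgue_measure R) E)%E.
Proof.
move=> k0 mE; apply/esym.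
apply: (@product_measure_unique _ _ _ _ _ _ _
  (pushforward (@lebesgue_measure R \x @lebesgue_measure R)%E (swap_scale R k)))
  => // [|mS A B mA mB]; first exact: measurable_swap_scale.
have k'0 : 0 < k^-1 by rewrite invr_gt0.
rewrite [LHS](_ : _ = (@lebesgue_measure R \x @lebesgue_measure R)%E
    (((fun x => k * x) @^-1` B) `*` ((fun x => k^-1 * x) @^-1` A))); last first.
  congr ((_ \x _)%E _).
  by apply/seteqP; split=> -[x y] /=; rewrite [k^-1 * _]mulrC => -[].
rewrite product_measure1E; last 2 first.
- have : measurable_fun setT (fun x : R => k * x) by exact: measurable_funM.
  by move=> /(_ measurableT B mB); rewrite setTI.
- have : measurable_fun setT (fun x : R => k^-1 * x) by exact: measurable_funM.
  by move=> /(_ measurableT A mA); rewrite setTI.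
have eB := lebesgue_measure_scale R k B k0 mB.
have eA := lebesgue_measure_scale R k^-1 A k'0 mA.
transitivity
  ((k^-1%:E * lebesgue_measure B) * (k^-1^-1%:E * lebesgue_measure A))%E.
  by congr (_ * _)%E.
rewrite invrK muleACA -EFinM mulVf ?gt_eqF // mul1e.
by rewrite muleC.
Qed.

(** * Products of a law having a density on the line *)

Section density.
Context (R : realType) (mu : probability (measurableTypeR R) R)
  (F : measurableTypeR R -> R).
Hypotheses (mF : measurable_fun setT F) (F0 : forall x, 0 <= F x).
Hypothesis muF : forall A, measurable A ->
  mu A = (\int[@lebesgue_measure R]_(x in A) (F x)%:E)%E.
Local Open Scope ereal_scope.
Local Notation leb := (@lebesgue_measure R).

(** [F] and the Radon-Nikodym derivative of [mu] have the same integral over every measurable set,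
    so they agree almost everywhere, and the change of variables for the derivative carries over to
    [F]. *)
Lemma ge0_integral_density (g : measurableTypeR R -> \bar R) :
  measurable_fun setT g -> (forall x, 0 <= g x) ->
  \int[mu]_x g x = \int[leb]_x (g x * (F x)%:E).
Proof.
move=> mg g0.
have mu_leb : mu `<< leb.
  apply/null_content_dominatesP => A mA A0; rewrite muF //.
  apply: null_set_integral => //.
  by apply/measurable_funTS/measurable_EFinP.
rewrite -(Radon_Nikodym_SigmaFinite.change_of_variables mu_leb) //.
have RNm := measurable_int _ (Radon_Nikodym_SigmaFinite.f_integrable mu_leb).
apply: ge0_ae_eq_integral => //.
- exact: emeasurable_funM.
- by apply: emeasurable_funM => //; exact/measurable_EFinP.
- by move=> x _; rewrite mule_ge0 // Radon_Nikodym_SigmaFinite.f_ge0.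
- by move=> x _; rewrite mule_ge0 // lee_fin.
apply: ae_eqe_mul2l; apply: integral_ae_eq => //.
- exact: Radon_Nikodym_SigmaFinite.f_integrable.
- exact/measurable_EFinP.
- move=> E _ mE.
  by rewrite -Radon_Nikodym_SigmaFinite.f_integral // -muF.
Qed.

Lemma product_density (E : set (plane R)) : measurable E ->
  (mu \x mu) E = \int[leb \x leb]_z (\1_E z * (F z.1 * F z.2))%:E.
Proof.
move=> mE.
have m2 : measurable_fun setT
    (fun z : plane R => (\1_E z * (F z.1 * F z.2))%R).
  by do 2 apply: measurable_funM => //; exact: measurableT_comp.
rewrite fubini_tonelli1 //; [|exact/measurable_EFinP|]; last first.
  by move=> z; rewrite lee_fin !mulr_ge0.
rewrite /product_measure1 ge0_integral_density //; last first.
  exact: measurable_fun_xsection.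
apply: eq_integral => x _.
have mEx : measurable (xsection E x) by exact: measurable_xsection.
rewrite /fubini_F /= muF // muleC integral_mkcond -ge0_integralZl //.
- apply: eq_integral => y _.
  rewrite patchE mem_xsection indicE; case: ifPn => _.
    by rewrite -EFinM mul1r.
  by rewrite mule0 mul0r.
- apply/(measurable_restrictT _ mEx)/measurable_funTS; exact/measurable_EFinP.
- by move=> y _; rewrite patchE; case: ifP; rewrite // lee_fin.
- by rewrite lee_fin.
Qed.

(** Since [swap_scale] preserves Lebesgue measure, the integral over [E'] can be pulled back along
    it; the two integrands then compare pointwise. *)
Lemma product_density_le (k : R) (E E' : set (plane R)) : (0 < k)%R ->
  measurable E -> measurable E' ->
  (forall p, E p -> E' (swap_scale R k p)) ->
  (forall p, E p ->
    F p.1 * F p.2 <= F (swap_scale R k p).1 * F (swap_scale R k p).2)%R ->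
  (mu \x mu) E <= (mu \x mu) E'.
Proof.
move=> k0 mE mE' EE' EF; rewrite !product_density //.
pose h A (z : plane R) := (\1_A z * (F z.1 * F z.2))%:E.
have mh A : measurable A -> measurable_fun setT (h A).
  move=> mA; apply/measurable_EFinP.
  by do 2 apply: measurable_funM => //; exact: measurableT_comp.
have h0 A z : 0 <= h A z by rewrite lee_fin !mulr_ge0.
have -> : \int[leb \x leb]_z h E' z =
    \int[leb \x leb]_z h E' (swap_scale R k z).
  transitivity (\int[pushforward (leb \x leb) (swap_scale R k)]_z h E' z).
    apply: eq_measure_integral => [|mS A mA _].
      exact: measurable_swap_scale.
    by apply/esym; exact: lebesgue_swap_scale.
  rewrite ge0_integral_pushforward //; [exact: measurable_swap_scale|exact: mh].
apply: ge0_le_integral => //.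
- by move=> z _; exact: h0.
- exact: (mh E mE).
- apply: (measurableT_comp (mh E' mE')); exact: measurable_swap_scale.
move=> z _; rewrite lee_fin !indicE.
have [zE|zE] := boolP (z \in E); last by rewrite mul0r !mulr_ge0.
move: zE; rewrite inE => zE.
by rewrite mem_set ?mul1r; [exact: EF|exact: EE'].
Qed.

End density.

(** * Log-concavity and the comparison for two weights *)

Lemma log_concave_exp_prod_le (R : realType) (f : R -> R) (x1 x2 p q : R) :
  log_concave (fun x : R^o => f (expR x)) ->
  0 < x1 -> x1 <= p <= x2 -> p * q = x1 * x2 -> f x1 * f x2 <= f p * f q.
Proof.
move=> [f0 supp_convex ln_concave] x1_gt0 /andP[x1p px2] pq.
have p_gt0 : 0 < p by exact: lt_le_trans x1p.
have x2_gt0 : 0 < x2 by exact: lt_le_trans px2.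
have q_gt0 : 0 < q by rewrite -(pmulr_rgt0 _ p_gt0) pq mulr_gt0.
have f_ge0 x : 0 < x -> 0 <= f x.
  by move=> x_gt0; have := f0 (ln x); rewrite lnK.
(* Concavity of the logarithm is available only on the support, so zeros of f at the endpoints are
   dealt with first. *)
have [f1|f1] := eqVneq (f x1) 0; first by rewrite f1 mul0r mulr_ge0 ?f_ge0.
have [f2|f2] := eqVneq (f x2) 0; first by rewrite f2 mulr0 mulr_ge0 ?f_ge0.
have f1_gt0 : 0 < f x1 by rewrite lt_neqAle eq_sym f1 f_ge0.
have f2_gt0 : 0 < f x2 by rewrite lt_neqAle eq_sym f2 f_ge0.
have lnpq : ln p + ln q = ln x1 + ln x2 by rewrite -!lnM ?posrE // pq.
have ln1p : ln x1 <= ln p by rewrite ler_ln.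
have lnp2 : ln p <= ln x2 by rewrite ler_ln.
(* ln p lies between ln x1 and ln x2, and ln q is its mirror image in the segment. The same t, with
   endpoints exchanged, thus serves for q, and the two concavity inequalities add up to the
   claim. *)
have [t [t0 [t1 pE]]] : exists t : R,
    0 <= t /\ (t <= 1 /\ ln p = t * ln x1 + (1 - t) * ln x2).
  have [e|ne] := eqVneq (ln x1) (ln x2).
    exists 0; split=> //; split=> //.
    by apply/eqP; rewrite eq_le; apply/andP; split; lra.
  have D0 : 0 < ln x2 - ln x1 by rewrite subr_gt0 lt_neqAle ne (le_trans ln1p).
  exists ((ln x2 - ln p) / (ln x2 - ln x1)); split.
    by apply: divr_ge0; [rewrite subr_ge0|exact: ltW].
  split; first by rewrite ler_pdivrMr // mul1r lerD2l lerN2.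
  by field; rewrite gt_eqF.
have qE : ln q = t * ln x2 + (1 - t) * ln x1 by move: pE lnpq; lra.
have in1 : (ln x1 : convex_lmodType R^o) \in
    [set x : convex_lmodType R^o | 0 < f (expR x)].
  by rewrite inE /= lnK.
have in2 : (ln x2 : convex_lmodType R^o) \in
    [set x : convex_lmodType R^o | 0 < f (expR x)].
  by rewrite inE /= lnK.
pose t01 : {i01 R} := Itv01 t0 t1.
have convE (x y : convex_lmodType R^o) :
  conv t01 x y = t * (x : R) + (1 - t) * (y : R) :> R by [].
have := supp_convex _ _ t01 in1 in2; have := supp_convex _ _ t01 in2 in1.
rewrite !inE /= !convE -pE -qE !lnK ?posrE // => fq_gt0 fp_gt0.
have := ln_concave t01 _ _ in1 in2; have := ln_concave t01 _ _ in2 in1.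
rewrite !convE -pE -qE !lnK ?posrE // => leq lep.
rewrite -ler_ln ?posrE ?mulr_gt0 // !lnM ?posrE //.
have {}lep : - ln (f p) <= t * - ln (f x1) + (1 - t) * - ln (f x2) := lep.
have {}leq : - ln (f q) <= t * - ln (f x2) + (1 - t) * - ln (f x1) := leq.
by move: leq lep; lra.
Qed.

Lemma measurable_half_plane (R : realType) (a1 a2 s : R) :
  measurable [set p : plane R |
    a1 * p.1 + a2 * p.2 <= s].
Proof.
have mL : measurable_fun setT (fun p : plane R =>
    (a1 * p.1 + a2 * p.2 : R)).
  by apply: measurable_funD; apply: measurable_funM => //.
have := mL measurableT `]-oo, s]%classic (measurable_itv _).
by rewrite setTI; congr measurable; apply/seteqP; split=> p /=; rewrite in_itv.
Qed.

Section two_weights.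
Context (R : realType) (f : R -> R).
Hypothesis mf : measurable_fun (`]0, +oo[%classic : set R) f.
Hypothesis f0 : forall x : R, 0 < x -> 0 <= f x.
Hypothesis f_lc : log_concave (fun x : R^o => f (expR x)).
Local Notation G := (measurableTypeR R).
Context (mu : probability G R).
Hypothesis muf : forall A : set R, measurable A ->
  mu A = (\int[@lebesgue_measure R]_(x in A `&` `]0%R, +oo[) (f x)%:E)%E.

Let half (a1 a2 s : R) : set (plane R) := [set p | a1 * p.1 + a2 * p.2 <= s].

Let mhalf (a1 a2 s : R) : measurable (half a1 a2 s).
Proof. exact: measurable_half_plane. Qed.

Lemma half_plane_le (a1 a2 b1 b2 s : R) :
  0 < a2 -> 0 < b2 -> b2 <= a1 <= b1 -> a1 * a2 = b1 * b2 ->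
  ((mu \x mu) [set p | (b1 * p.1 + b2 * p.2 <= s)%R] <=
   (mu \x mu) [set p | (a1 * p.1 + a2 * p.2 <= s)%R])%E.
Proof.
move=> a2_gt0 b2_gt0 /andP[b2a1 a1b1] ab.
have a1_gt0 : 0 < a1 by exact: lt_le_trans b2a1.
have b1_gt0 : 0 < b1 by exact: lt_le_trans a1b1.
have a2b1 : a2 <= b1.
  rewrite -(ler_pM2l a1_gt0) ab mulrC ler_pM2r //.
rewrite -/(half b1 b2 s) -/(half a1 a2 s).
(* The common part of the two half-planes is split off, leaving only the two set differences to
   compare. *)
rewrite (measureDI (mu \x mu)%E (mhalf b1 b2 s) (mhalf a1 a2 s)).
rewrite (measureDI (mu \x mu)%E (mhalf a1 a2 s) (mhalf b1 b2 s)).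
rewrite [X in (_ + (mu \x mu)%E X <= _)%E]setIC; apply: leeD2r.
have k_gt0 : 0 < b1 / a2 by rewrite divr_gt0.
(* With k = b1 / a2, which also equals a1 / b2, these two identities say that [swap_scale] exchanges
   the linear forms. *)
have L1 x y : a1 * (y / (b1 / a2)) + a2 * ((b1 / a2) * x) = b1 * x + b2 * y.
  have -> : b2 = a1 * a2 / b1 by rewrite ab mulrAC mulfV ?mul1r ?gt_eqF.
  by field; rewrite !gt_eqF.
have L2 x y : b1 * (y / (b1 / a2)) + b2 * ((b1 / a2) * x) = a1 * x + a2 * y.
  have -> : a1 = b1 * b2 / a2 by rewrite -ab mulfK ?gt_eqF.
  by field; rewrite !gt_eqF.
(* Values of f off the positive half-line are arbitrary, so the density on the whole line is f
   extended by zero. *)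
pose F := f \_ `]0, +oo[.
have mI : measurable (`]0, +oo[%classic : set R) by exact: measurable_itv.
have F0 x : 0 <= F x.
  rewrite /F patchE; case: ifPn => //.
  by rewrite inE /= in_itv /= andbT; exact: f0.
have F_pos x : 0 < x -> F x = f x.
  by move=> x_gt0; rewrite /F patchE mem_set //= in_itv /= x_gt0.
have F_npos x : x <= 0 -> F x = 0.
  move=> x_le0; rewrite /F patchE memNset //= in_itv /= andbT.
  by apply/negP; rewrite -leNgt.
apply: (product_density_le R mu F _ F0 _ (b1 / a2)) => //.
- exact/(measurable_restrictT _ mI).
- move=> A mA; rewrite muf // integral_mkcondr.
  by apply: eq_integral => x _; rewrite /F restrict_EFin.
- by apply: measurableD; exact: mhalf.
- by apply: measurableD; exact: mhalf.
- move=> [x y] [] /= Eb Ea; rewrite /swap_scale /half /= L1 L2.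
  by split.
(* Subtracting the inequalities, (b1 - a1) x < (a2 - b2) y, that is k x < y. *)
- move=> [x y] [] Eb /negP; rewrite -ltNge => Ea.
  have {}Eb : b1 * x + b2 * y <= s := Eb.
  have {}Ea : s < a1 * x + a2 * y := Ea.
  have [x_le0|x_gt0] := leP x 0; first by rewrite F_npos // mul0r mulr_ge0.
  have [y_le0|y_gt0] := leP y 0; first by rewrite [F y]F_npos // mulr0 mulr_ge0.
  rewrite /swap_scale /= !F_pos ?mulr_gt0 ?invr_gt0 ?mulr_gt0 ?invr_gt0 //.
  have kx_y : b1 / a2 * x <= y.
    rewrite mulrAC ler_pdivrMr //.
    have : (b1 - a1) * x < (a2 - b2) * y by lra.
    rewrite -(ltr_pM2l b1_gt0).
    (* Since b1 b2 = a1 a2, the factor b1 - a1 appears on both sides. It cannot vanish in a strict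
       inequality, so it cancels. *)
    have -> : b1 * ((a2 - b2) * y) = (b1 - a1) * (a2 * y).
      by rewrite mulrA mulrBr -ab -mulrBl mulrA.
    rewrite mulrCA => lt_xy; rewrite (mulrC y).
    have : 0 <= b1 - a1 by rewrite subr_ge0.
    rewrite le_eqVlt => /predU1P[e|d_gt0].
      by move: lt_xy; rewrite -e !mul0r ltxx.
    by move: lt_xy; rewrite ltr_pM2l // => /ltW.
  have k_ge1 : 1 <= b1 / a2 by rewrite ler_pdivlMr // mul1r.
  (* Used with endpoints x, y and inner points y / k, k x: the bounds x <= y / k <= y follow from k
     x <= y and k >= 1. *)
  apply: log_concave_exp_prod_le => //; last first.
    by rewrite mulrA divfK ?gt_eqF // mulrC.
  rewrite ler_pdivlMr // mulrC kx_y /= ler_pdivrMr //.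
  by rewrite ler_peMr // ltW.
Qed.

End two_weights.

(** * Transfers between two weights in the full sum *)

Section transfer.
Context (R : realType) (n : nat) (d : measure_display) (T : measurableType d)
  (P : probability T R) (Y : 'I_n -> {RV P >-> R}) (f : R -> R).
Hypothesis Yindep : mutually_independent Y.
Hypothesis Ydens : forall i : 'I_n, has_density (Y i) `]0, +oo[ f.
Hypothesis f_lc : log_concave (fun x : R^o => f (expR x)).

Lemma pair_half_plane_le (i j : 'I_n) (a1 a2 b1 b2 s : R) :
  i != j -> 0 < a2 -> 0 < b2 -> b2 <= a1 <= b1 -> a1 * a2 = b1 * b2 ->
  (P [set w | (b1 * Y i w + b2 * Y j w <= s)%R] <=
   P [set w | (a1 * Y i w + a2 * Y j w <= s)%R])%E.
Proof.
move=> ij a2_gt0 b2_gt0 a1b ab.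
have [mf f0 _] := Ydens i.
have mYG k : measurable_fun setT (Y k : T -> measurableTypeR R).
  by have mYk : measurable_fun setT (Y k) by []; exact: mYk.
pose YG : {RV P >-> measurableTypeR R} := HB.pack (Y i : T -> measurableTypeR R)
  (isMeasurableFun.Build _ _ _ _ _ (mYG i)).
pose mu : probability (measurableTypeR R) R := distribution P YG.
(* All [Y k] have the same density, so the law of [Y i] serves for both coordinates. *)
have muE k (A : set R) : measurable A -> P (Y k @^-1` A) = mu A.
  move=> mA; have [_ _ /(_ A mA)] := Ydens i; have [_ _ /(_ A mA)] := Ydens k.
  by rewrite /distribution /pushforward => -> <-.
have law c1 c2 : P [set w | (c1 * Y i w + c2 * Y j w <= s)%R] =
    (mu \x mu)%E [set p | (c1 * p.1 + c2 * p.2 <= s)%R].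
  apply: (indep_law_pair R _ _ _ _ P _ _ _ _ mu mu (mYG i) (mYG j)).
    move=> A B mA mB; rewrite -(muE i A) // -(muE j B) //.
    exact: pair_indep.
  exact: measurable_half_plane.
rewrite !law; apply: (half_plane_le R f) => //.
- by move=> x x_gt0; apply: f0; rewrite /= in_itv /= x_gt0.
- by move=> A mA; have [_ _ /(_ A mA)] := Ydens i.
Qed.

(** The remaining terms form a variable Z that is common to both sums and independent of (Y_i, Y_j).
    Given Z = z, the claim is the two-weight comparison at level t - z. *)
Lemma weighted_sum_cdf_le (i j : 'I_n) (a b : 'rV[R]_n) (t : R) :
  i != j -> (forall k, k != i -> k != j -> a ord0 k = b ord0 k) ->
  0 < a ord0 j -> 0 < b ord0 j -> b ord0 j <= a ord0 i <= b ord0 i ->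
  a ord0 i * a ord0 j = b ord0 i * b ord0 j ->
  (cdf (weighted_sum b Y : {RV P >-> R}) t <=
   cdf (weighted_sum a Y : {RV P >-> R}) t)%E.
Proof.
move=> ij abE aj bj a_itv ab_prod.
pose s := [seq k <- index_enum 'I_n | (k != i) && (k != j)].
pose c k := a ord0 k.
have sumE (e : 'rV[R]_n) w :
    (forall k, k != i -> k != j -> a ord0 k = e ord0 k) ->
    weighted_sum e Y w =
    e ord0 i * Y i w + e ord0 j * Y j w + \sum_(k <- s) c k * Y k w.
  move=> ae; rewrite /weighted_sum (bigD1 i) //= (bigD1 j) 1?eq_sym //= addrA.
  rewrite big_filter; congr (_ + _).
  by apply: eq_bigr => k /andP[ki kj]; rewrite /c ae.
have us : uniq s by rewrite filter_uniq // index_enum_uniq.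
have iS : i \notin s by rewrite mem_filter eqxx.
have jS : j \notin s by rewrite mem_filter eqxx andbF.
have mZ : measurable_fun setT (fun w => \sum_(k <- s) c k * Y k w).
  by apply: measurable_sum => k; exact: measurable_funM.
pose Z : {RV P >-> R} := HB.pack (fun w => \sum_(k <- s) c k * Y k w)
  (isMeasurableFun.Build _ _ _ _ _ mZ).
have mYY : measurable_fun setT (fun w => (Y i w, Y j w)).
  by apply: measurable_fun_pair.
pose YY : {RV P >-> (R * R)%type} := HB.pack (fun w => (Y i w, Y j w))
  (isMeasurableFun.Build _ _ _ _ _ mYY).
(* Z is the first coordinate because the product measure integrates the measures of sections over
   its first factor. *)
pose E (e : 'rV[R]_n) : set (R * (R * R)) :=
  [set q | e ord0 i * q.2.1 + e ord0 j * q.2.2 + q.1 <= t].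
have mE e : measurable (E e).
  have mL : measurable_fun setT
      (fun q : R * (R * R) => e ord0 i * q.2.1 + e ord0 j * q.2.2 + q.1).
    by do 2 apply: measurable_funD => //; apply: measurable_funM => //;
      apply: measurableT_comp.
  have := mL measurableT `]-oo, t]%classic (measurable_itv _).
  by rewrite setTI; congr measurable; apply/seteqP; split=> q /=;
    rewrite in_itv.
have law (e : 'rV[R]_n) : (forall k, k != i -> k != j -> a ord0 k = e ord0 k) ->
    cdf (weighted_sum e Y : {RV P >-> R}) t =
    (distribution P Z \x distribution P YY)%E (E e).
  move=> ae; rewrite -(indep_law_pair R _ _ _ _ P _ _ Z YY) //; last first.
    move=> A B mA mB; rewrite setIC muleC; exact: pair_indep_sum.
  rewrite /cdf /distribution /pushforward; congr (P _).
  by apply/seteqP; split=> w; rewrite /E /= in_itv /= sumE.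
rewrite !law //.
apply: ge0_le_integral => //; try exact: measurable_fun_xsection.
move=> z _.
have secE e : distribution P YY (xsection (E e) z) =
    P [set w | e ord0 i * Y i w + e ord0 j * Y j w <= t - z].
  congr (P _); apply/seteqP; split=> w /=; rewrite /xsection /= inE /E /=;
  by rewrite lerBrDr.
by rewrite /= !secE; exact: pair_half_plane_le.
Qed.

End transfer.

Theorem theorem1 (R : realType) (n : nat) (hn : (1 <= n)%N)
    (d : measure_display) (T : measurableType d) (P : probability T R)
    (Y : 'I_n -> {RV P >-> R}) (f : R -> R)
    (hindep : mutually_independent Y)
    (hdens : forall i : 'I_n, has_density (Y i) `]0, +oo[ f)
    (hlc : log_concave (fun x : R^o => f (expR x))) :
  (forall t : R, 0 < t ->
     schur_concave (fun alpha : 'rV[R]_n =>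
       fine (cdf (weighted_sum (map_mx expR alpha) Y : {RV P >-> R}) t))) /\
  (forall a b : 'rV[R]_n,
     (forall i : 'I_n, 0 < a ord0 i) -> (forall i : 'I_n, 0 < b ord0 i) ->
     majorized (map_mx (@ln R) a) (map_mx (@ln R) b) ->
     st_le (weighted_sum a Y : {RV P >-> R})
           (weighted_sum b Y : {RV P >-> R})).
Proof.
have cdf_fin (a : 'rV[R]_n) t :
    cdf (weighted_sum a Y : {RV P >-> R}) t \is a fin_num.
  by rewrite fin_num_measure.
(* Kept for every real t, as the stochastic order compares tails at all thresholds. *)
have cdf_schur t : schur_concave (fun alpha : 'rV[R]_n =>
    fine (cdf (weighted_sum (map_mx expR alpha) Y : {RV P >-> R}) t)).
  apply: transfer_monotone_schur_concave => i j a b ij abE ab_sum.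
  move=> /andP[bja aib]; apply: fine_le => //.
  apply: (weighted_sum_cdf_le _ _ _ _ _ _ f hindep hdens hlc i j).
  - exact: ij.
  - by move=> k ki kj; rewrite !mxE abE.
  - by rewrite mxE expR_gt0.
  - by rewrite mxE expR_gt0.
  - by rewrite !mxE !ler_expR bja.
  (* The exponential turns the preserved sum of logarithms into a preserved product of weights. *)
  - by rewrite !mxE -!expRD ab_sum.
split=> [t _|a b a_gt0 b_gt0 maj t]; first exact: cdf_schur.
have lnK_mx (c : 'rV[R]_n) : (forall i, 0 < c ord0 i) ->
    map_mx expR (map_mx (@ln R) c) = c.
  by move=> c_gt0; apply/rowP => i; rewrite !mxE lnK // posrE.
have [_ /(_ _ _ maj)] := cdf_schur t.
(* Passing to complements reverses the inequality between distribution functions. *)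
rewrite !lnK_mx // => cdf_le; rewrite !ccdf_1_cdf leeB //.
by rewrite -(fineK (cdf_fin a t)) -(fineK (cdf_fin b t)) lee_fin.
Qed.
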